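(* Fix $n\geq3$ and run the $n$-GHZ state generation protocol (see context), and suppose it heralds success with some measurement pattern $\vec m$. Assume all input photons except those in input modes $2i,2i+1$ (for a fixed $0\le i<n$) are ideal, with internal state $\eta_0=|\psi_0\rangle\langle\psi_0|$, and let $\eta_1=|\psi_1\rangle\langle\psi_1|$ with $\mathrm{Tr}(\eta_0\eta_1)=0$. (1) If the input photons in modes $2i,2i+1$ are in the state $\frac12\big(a^\dagger_{2i}(\eta_0)a^\dagger_{2i+1}(\eta_1)|\vec0\rangle\langle\vec0|a_{2i+1}(\eta_1)a_{2i}(\eta_0)+a^\dagger_{2i}(\eta_1)a^\dagger_{2i+1}(\eta_0)|\vec0\rangle\langle\vec0|a_{2i+1}(\eta_0)a_{2i}(\eta_1)\big)$, then after dual-rail projection the output state is $\frac12P_{X_i}\big(P_{Z_i}(|B_+\rangle\langle B_+|)+D_i(|B_+\rangle\langle B_+|)\big)$. (2) If instead both input photons in modes $2i,2i+1$ have the same internal state $\eta_1$, then the output state is $P_{Z_i}(D_i(|B_+\rangle\langle B_+|))$, with no dual-rail projection required.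
   Context: Photonic model: $a_j^\dagger(\eta)$ creates a photon in spatial mode $j$ with internal state $\eta$ (pure); linear optics acts on spatial modes only; photon-number-resolving (PNR) detection reveals only photon number per spatial mode, with post-measurement states obtained by projecting and tracing out internal states of measured photons. Hadamard beamsplitter $H$ on ordered pair $(p,q)$: $a_p^\dagger\mapsto(a_p^\dagger+a_q^\dagger)/\sqrt2$, $a_q^\dagger\mapsto(a_p^\dagger-a_q^\dagger)/\sqrt2$. The $n$-GHZ state analyzer on $2n$ modes labeled $0,\dots,2n-1$: apply $H$ to each ordered pair in $\{(1,2),(3,4),\dots,(2n-3,2n-2),(2n-1,0)\}$, PNR-measure all modes getting $(m_0,\dots,m_{2n-1})$, succeed iff $m_{2k+1}+m_{2k+2}=1$ for all $0\le k<n$ ($m_{2n}=m_0$); it reports $(-1)^{s_{\mathrm{odd}}}$ as the value of $X\cdots X$, where $s_{\mathrm{odd}}$ is the number of photons detected in its odd-indexed modes. The $n$-GHZ generation protocol on modes $0,\dots,4n-1$: (1) input one photon in each of modes $0,\dots,2n-1$, vacuum elsewhere; (2) apply $H$ on each $(2k,2k+1)$, $0\le k<n$; (3) apply $H$ on each $(k,2n+k)$, $0\le k<2n$; (4) apply the $n$-GHZ analyzer to modes $2n,\dots,4n-1$ (mode $2n+j$ as analyzer mode $j$), proceeding iff success; (5) if the analyzer reports $-1$, apply a phase $-1$ to mode $1$. Output: modes $0,\dots,2n-1$, viewed as $n$ dual-rail qubits on pairs $(2k,2k+1)$ with $|\mathbf0\rangle=|1,0\rangle,|\mathbf1\rangle=|0,1\rangle$;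 $X_k$ swaps the modes of qubit $k$, $Z_k$ applies phase $-1$ to mode $2k+1$. $|B_+\rangle=\frac1{\sqrt2}(|1,0\rangle^{\otimes n}+|0,1\rangle^{\otimes n})$ with all photons in internal state $\psi_0$. For an operator $A$, $P_A(\gamma)=\frac12(\gamma+A\gamma A^\dagger)$. $D_k$ is the operator on modes $2k,2k+1$ with $a_{2k}^\dagger(\psi_0)|\vec0\rangle\mapsto a_{2k}^\dagger(\psi_1)|\vec0\rangle$ and $a_{2k+1}^\dagger(\psi_0)|\vec0\rangle\mapsto a_{2k+1}^\dagger(\psi_1)|\vec0\rangle$ (changing the internal state of the photon of qubit $k$ to $\psi_1$), and $D_k(\rho)=D_k\rho D_k^\dagger$. Dual-rail projection: projecting (and renormalizing) onto the span of states with exactly one photon in each pair $(2k,2k+1)$. *)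

(* Defs.v *)
From HB Require Import structures.
From mathcomp Require Import all_boot all_order all_algebra all_field.
Set Implicit Arguments. Unset Strict Implicit. Unset Printing Implicit Defensive.
Import Order.TTheory GRing.Theory Num.Theory.
Local Open Scope ring_scope.

(* Spatial modes are natural numbers (modes 0 .. 4n-1 of the protocol).     *)
(* Internal states: only the two orthonormal pure states psi0, psi1 ever     *)
(* occur and linear optics does not act on them, so the internal label of a *)
(* photon is a boolean: false = psi0, true = psi1 (Tr(eta0 eta1) = 0).      *)
(* A Fock mode is a pair (spatial mode, internal label).                     *)

(* A linear-optics transformation on spatial modes, given by its action on
   creation operators:  a_s^dag |-> \sum_r U r s a_r^dag. *)
Definition Mat := nat -> nat -> algC.

Definition s2inv : algC := (sqrtC 2)^-1.

(* Hadamard beamsplitter on the ordered pair (p,q):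
   a_p^dag |-> (a_p^dag + a_q^dag)/sqrt2,  a_q^dag |-> (a_p^dag - a_q^dag)/sqrt2. *)
Definition hbs (p q : nat) : Mat := fun r s =>
  if s == p then (if r == p then s2inv else if r == q then s2inv else 0)
  else if s == q then (if r == p then s2inv else if r == q then - s2inv else 0)
  else (r == s)%:R.

Definition idm : Mat := fun r s => (r == s)%:R.

Definition mcomp (M : nat) (A B : Mat) : Mat :=
  fun r s => \sum_(q < M) A r q * B q s.

Definition bs_layer (M : nat) (prs : seq (nat * nat)) : Mat :=
  foldr (fun pr A => mcomp M (hbs pr.1 pr.2) A) idm prs.

Definition step2_pairs (n : nat) : seq (nat * nat) :=
  [seq ((2 * k)%N, (2 * k).+1) | k <- iota 0 n].
Definition step3_pairs (n : nat) : seq (nat * nat) :=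
  [seq (k, (2 * n + k)%N) | k <- iota 0 (2 * n)].
(* step (4): the analyzer's beamsplitters on analyzer modes
   (1,2),(3,4),...,(2n-3,2n-2),(2n-1,0); analyzer mode j is spatial mode 2n+j *)
Definition analyzer_pairs (n : nat) : seq (nat * nat) :=
  [seq ((2 * n + (2 * k).+1)%N, (2 * n + ((2 * k + 2) %% (2 * n)))%N)
  | k <- iota 0 n].

Definition Utot (n : nat) : Mat :=
  mcomp (4 * n) (bs_layer (4 * n) (analyzer_pairs n))
    (mcomp (4 * n) (bs_layer (4 * n) (step3_pairs n))
                   (bs_layer (4 * n) (step2_pairs n))).

(* Fock configurations.  There are 2n photons in total, so every occupation *)
(* number is at most 2n.  A configuration of 2n spatial modes (with both    *)
(* internal labels) is an element of Cf n.  Output modes 0..2n-1 and the    *)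
(* analyzer modes 2n..4n-1 (analyzer mode j = spatial 2n+j) are each        *)
(* described by an element of Cf n.                                          *)
Definition Cf (n : nat) := {ffun 'I_(2 * n) * bool -> 'I_(2 * n).+1}.

Definition cv (n : nat) (c : Cf n) (q : nat) (b : bool) : nat :=
  (\sum_(x : 'I_(2 * n) * bool | ((x.1 : nat) == q) && (x.2 == b)) (c x : nat))%N.

(* The input: photon t (0 <= t < 2n) in spatial mode t with internal label
   k t.  The input state is prod_t a_t^dag(psi_(k t)) |0>.  After the linear
   optics U it is prod_t (\sum_r U r t a_r^dag(psi_(k t))) |0>; expanding, a
   term is indexed by an assignment f : photon -> output spatial mode. *)
Definition PA (n : nat) := {ffun 'I_(2 * n) -> 'I_(4 * n)}.

Definition occ (n : nat) (f : PA n) (k : nat -> bool) (q : nat) (b : bool) : nat :=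
  #|[set t : 'I_(2 * n) | ((f t : nat) == q) && (k t == b)]|.

Definition compatible (n : nat) (f : PA n) (k : nat -> bool) (c d : Cf n) : bool :=
  [forall x : 'I_(2 * n) * bool,
     (occ f k x.1 x.2 == c x) && (occ f k (2 * n + x.1) x.2 == d x)].

Definition fact_w (n : nat) (c : Cf n) : algC :=
  \prod_(x : 'I_(2 * n) * bool) ((c x)`!)%:R.

(* amplitude <c,d | U | input k>  on the normalized Fock basis state |c,d>
   (using  (a^dag)^m |0> = sqrt(m!) |m>) *)
Definition amp (n : nat) (k : nat -> bool) (c d : Cf n) : algC :=
  sqrtC (fact_w c * fact_w d) *
  \sum_(f : PA n | compatible f k c d) \prod_(t < 2 * n) Utot n (f t) t.

Definition s_odd (n : nat) (m : nat -> nat) : nat := (\sum_(j < 2 * n | odd j) m j)%N.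

(* step (5): phase -1 on (spatial) mode 1 if the analyzer reports -1 *)
Definition corr (n : nat) (m : nat -> nat) (c : Cf n) : algC :=
  if odd (s_odd n m) then (-1) ^+ (cv c 1 false + cv c 1 true) else 1.

Definition meas_ok (n : nat) (m : nat -> nat) (d : Cf n) : bool :=
  [forall j : 'I_(2 * n), (d (j, false) + d (j, true) == m j)%N].

Definition Dens (n : nat) := Cf n -> Cf n -> algC.

(* unnormalized post-measurement output state for the pure input k and
   PNR outcome m: project the analyzer modes onto photon numbers m (summed
   over internal states) and trace out the measured photons (including their
   internal states); then apply the correction of step (5). *)
Definition rho_pure (n : nat) (k : nat -> bool) (m : nat -> nat) : Dens n :=
  fun c c' => \sum_(d : Cf n | meas_ok m d)
     (corr m c * amp k c d) * (corr m c' * amp k c' d)^*.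

Definition rho_mix (n : nat) (mix : seq (algC * (nat -> bool))) (m : nat -> nat)
  : Dens n :=
  fun c c' => \sum_(w <- mix) w.1 * rho_pure w.2 m c c'.

Definition trace (n : nat) (rho : Dens n) : algC := \sum_(c : Cf n) rho c c.
Definition normalize (n : nat) (rho : Dens n) : Dens n :=
  fun c c' => rho c c' / trace rho.

Definition success (n : nat) (m : nat -> nat) : bool :=
  [forall k : 'I_n, m (2 * k).+1 + m ((2 * k + 2) %% (2 * n)) == 1]%N.

Definition dr_conf (n : nat) (c : Cf n) : bool :=
  [forall k : 'I_n, cv c (2 * k) false + cv c (2 * k) true
                    + cv c (2 * k).+1 false + cv c (2 * k).+1 true == 1]%N.
Definition dr_proj (n : nat) (rho : Dens n) : Dens n :=
  fun c c' => if dr_conf c && dr_conf c' then rho c c' else 0.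

Definition Op (n : nat) := Cf n -> Cf n -> algC.
Definition mmul (n : nat) (A B : Op n) : Op n :=
  fun c c' => \sum_(c0 : Cf n) A c c0 * B c0 c'.
Definition adj (n : nat) (A : Op n) : Op n := fun c c' => (A c' c)^*.
Definition conj_op (n : nat) (A : Op n) (g : Dens n) : Dens n :=
  mmul (mmul A g) (adj A).
Definition dadd (n : nat) (g h : Dens n) : Dens n := fun c c' => g c c' + h c c'.
Definition dscale (n : nat) (a : algC) (g : Dens n) : Dens n := fun c c' => a * g c c'.
Definition P_op (n : nat) (A : Op n) (g : Dens n) : Dens n :=
  dscale (1 / 2) (dadd g (conj_op A g)).
Definition proj (n : nat) (v : Cf n -> algC) : Dens n := fun c c' => v c * (v c')^*.

Definition partner (q : nat) : nat := if odd q then q.-1 else q.+1.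

Definition Xconf (n k : nat) (c : Cf n) : Cf n :=
  [ffun x : 'I_(2 * n) * bool => inord (if ((x.1 : nat)./2 == k)%N then cv c (partner x.1) x.2
                    else (c x : nat))].
Definition Xop (n k : nat) : Op n := fun c c0 => (c == Xconf k c0)%:R.

Definition Zop (n k : nat) : Op n := fun c c0 =>
  (c == c0)%:R * (-1) ^+ (cv c0 (2 * k).+1 false + cv c0 (2 * k).+1 true).

(* D_k changes the internal state of the (single) photon of qubit k from psi0
   to psi1:  a_(2k)^dag(psi0)|0> |-> a_(2k)^dag(psi1)|0>, and likewise for
   mode 2k+1.  We extend it unitarily by exchanging psi0 <-> psi1 on the
   single-photon states of modes 2k,2k+1 and acting as the identity on the
   other photon-number sectors of these modes (irrelevant for the theorem). *)
Definition qubit_single (n k : nat) (c : Cf n) : bool :=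
  (cv c (2 * k) false + cv c (2 * k) true
   + cv c (2 * k).+1 false + cv c (2 * k).+1 true == 1)%N.
Definition Dconf (n k : nat) (c : Cf n) : Cf n :=
  [ffun x : 'I_(2 * n) * bool => inord (if ((x.1 : nat)./2 == k)%N && qubit_single k c
                    then cv c x.1 (~~ x.2) else (c x : nat))].
Definition Dop (n k : nat) : Op n := fun c c0 => (c == Dconf k c0)%:R.

(* dual-rail basis configuration: qubit k has its photon in mode 2k + s k
   (|0> = |1,0>, |1> = |0,1>) with internal label intl k *)
Definition drket (n : nat) (s intl : nat -> bool) : Cf n :=
  [ffun x : 'I_(2 * n) * bool => inord (((odd x.1 == s (x.1)./2) && (x.2 == intl (x.1)./2)) : nat)].

Definition Bplus (n : nat) : Cf n -> algC := fun c =>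
  s2inv * ((c == drket n (fun _ => false) (fun _ => false))%:R
           + (c == drket n (fun _ => true) (fun _ => false))%:R).

Definition target1 (n i : nat) : Dens n :=
  dscale (1 / 2) (P_op (@Xop n i)
     (dadd (P_op (@Zop n i) (proj (@Bplus n)))
           (conj_op (@Dop n i) (proj (@Bplus n))))).

Definition target2 (n i : nat) : Dens n :=
  P_op (@Zop n i) (conj_op (@Dop n i) (proj (@Bplus n))).

(* Main.v *)
(* A photon entering pair k leaves in an output mode 2k or 2k+1 or in one of the
   two analyzer pairs k-1 and k, and the place where it leaves determines the rail
   (0 or 1) it took; up to the sign (-1)^rail, the two inputs of a pair have equal
   amplitudes.  Exchanging two indistinguishable photons of one pair that took
   different rails therefore flips the sign of a term of the amplitude, so these
   terms cancel (Hong-Ou-Mandel).  In a surviving term, the heralding condition (one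
   click per analyzer pair) excludes that photons on rail 1 of pair k and on rail 0
   of pair k+1 are both detected; going around the cycle, all detected photons took
   the same rail s.  Hence a term is given by s, by the rail t of the output photon
   of pair i, and by the choice, for every pair, of the input photon that is
   detected.  The amplitudes have equal modulus, and the outputs for different (s,t)
   are coherent exactly when the internal state of the detected photon of pair i does
   not reveal where it was detected. *)
Require Import Defs.
From HB Require Import structures.
From mathcomp Require Import all_boot all_order all_algebra all_field.
From mathcomp Require Import zify ring.
Import Order.TTheory GRing.Theory Num.Theory.
Local Open Scope ring_scope.
Set Implicit Arguments. Unset Strict Implicit. Unset Printing Implicit Defensive.

(** * Entries of the interferometer *)

Definition inpair (pr : nat * nat) (s : nat) := (s == pr.1) || (s == pr.2).

Lemma hbs_off p q r s : ~~ inpair (p, q) s -> hbs p q r s = (r == s)%:R.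
Proof. by rewrite /hbs /inpair /= negb_or => /andP[/negbTE -> /negbTE ->]. Qed.

Lemma hbs_row_off p q r s : ~~ inpair (p, q) r -> hbs p q r s = (r == s)%:R.
Proof.
rewrite /hbs /inpair /= negb_or => /andP[rp rq].
case: eqP => [->|_]; first by rewrite (negbTE rp) (negbTE rq).
by case: eqP => [->|//]; rewrite (negbTE rp) (negbTE rq).
Qed.

Lemma sum_delta M (G : nat -> algC) s : (s < M)%N ->
  \sum_(q < M) G q * (q == s :> nat)%:R = G s.
Proof.
move=> sM; rewrite (bigD1 (Ordinal sM)) //= eqxx mulr1 big1 ?addr0 // => q.
by rewrite -val_eqE /= => /negbTE ->; rewrite mulr0.
Qed.

Lemma bs_layer_off M (I : eqType) (g : I -> nat * nat) (ks : seq I) r s :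
  (s < M)%N -> {in ks, forall k, ~~ inpair (g k) s} ->
  bs_layer M [seq g k | k <- ks] r s = (r == s)%:R.
Proof.
move=> sM; elim: ks r => [//|k ks IH] r out.
rewrite /bs_layer /= -/(bs_layer M _) /mcomp.
under eq_bigr => q _.
  rewrite IH; last by move=> k' k'ks; apply: out; rewrite in_cons k'ks orbT.
  over.
by rewrite sum_delta // hbs_off // -surjective_pairing out ?mem_head.
Qed.

(** The pairs of a layer are disjoint, so a photon entering in [s] meets one beamsplitter and stays
    inside its pair. *)
Lemma bs_layer_on M (I : eqType) (g : I -> nat * nat) (ks : seq I) k r s :
  uniq ks -> k \in ks -> (r < M)%N -> (s < M)%N ->
  {in ks &, forall k1 k2 t, inpair (g k1) t -> inpair (g k2) t -> k1 = k2} ->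
  inpair (g k) s ->
  bs_layer M [seq g k | k <- ks] r s = hbs (g k).1 (g k).2 r s.
Proof.
move=> + + + sM; elim: ks r => [//|k' ks IH] r /= /andP[k'ks uks] kks rM disj ks_s.
rewrite /bs_layer /= -/(bs_layer M _) /mcomp.
have [ek|nk] := eqVneq k k'.
  subst k'; under eq_bigr => q _.
    rewrite bs_layer_off //; first over.
    move=> k2 k2ks; apply/negP => k2_s; move/negP: k'ks; apply.
    by rewrite (disj k k2 _ _ s ks_s) ?mem_head // in_cons k2ks orbT.
  by rewrite sum_delta.
have kks' : k \in ks by move: kks; rewrite in_cons (negbTE nk).
under eq_bigr => q _.
  rewrite IH //; last first.
    by move=> k1 k2 i1 i2; apply: disj; rewrite in_cons ?i1 ?i2 orbT.
  over.
(* For [q] in the pair of [k], the beamsplitter of [k'] is the identity there; for any other [q],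
   the factor of [k] is a delta that vanishes, as [s] lies in the pair of [k]. *)
have E q : hbs (g k').1 (g k').2 r q * hbs (g k).1 (g k).2 q s =
           hbs (g k).1 (g k).2 q s * (q == r)%:R.
  have [iq|niq] := boolP (inpair (g k) q).
    rewrite mulrC [hbs (g k').1 _ _ _]hbs_off 1?eq_sym // -surjective_pairing.
    apply/negP => iq'.
    move/eqP: nk; apply; apply: (disj _ _ _ _ q); rewrite ?mem_head //.
  have -> : hbs (g k).1 (g k).2 q s = (q == s)%:R.
    by rewrite hbs_row_off // -surjective_pairing.
  by case: eqP => [eq_qs|_]; rewrite ?mul0r ?mulr0 // -eq_qs (negbTE niq) in ks_s *.
under eq_bigr => q _ do rewrite E.
exact: (sum_delta (fun q => hbs (g k).1 (g k).2 q s)).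
Qed.

(** * Numbering of modes by pair and rail *)

Definition enc n (x : 'I_n * bool) : nat := (2 * x.1 + x.2)%N.

Lemma enc_lt n (x : 'I_n * bool) : (enc x < 2 * n)%N.
Proof. by rewrite /enc; case: x => k [] /=; have := ltn_ord k; lia. Qed.

Lemma enc_inj n : injective (@enc n).
Proof.
move=> [k b] [k' b']; rewrite /enc /= => E.
have {}E : (k : nat) = k' /\ b = b' by case: b b' E => [] []; lia.
by case: E => /val_inj -> ->.
Qed.

Definition mode n (x : 'I_n * bool) : 'I_(2 * n) := Ordinal (enc_lt x).

Lemma mode_inj n : injective (@mode n).
Proof. by move=> x y /(congr1 val) /enc_inj. Qed.

Lemma mode_bij n : bijective (@mode n).
Proof.
apply: inj_card_bij; first exact: mode_inj.
by rewrite card_prod card_bool !card_ord mulnC.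
Qed.

Lemma dest_lt n (y : bool * ('I_n * bool)) :
  ((if y.1 then 2 * n else 0) + enc y.2 < 4 * n)%N.
Proof. by have := enc_lt y.2; case: y.1; lia. Qed.

(** The boolean tells whether the photon goes to the analyzer (spatial modes from [2 * n] on) or
    stays among the output modes. *)
Definition dest n (y : bool * ('I_n * bool)) : 'I_(4 * n) := Ordinal (dest_lt y).

Lemma dest_inj n : injective (@dest n).
Proof.
move=> [a x] [a' x'] /(congr1 val) /= E.
have := enc_lt x; have := enc_lt x'.
case: a a' E => [] [] E *; [| lia | lia |].
  by move/addnI/enc_inj: E => ->.
by move/addnI/enc_inj: E => ->.
Qed.

Lemma dest_bij n : bijective (@dest n).
Proof.
apply: inj_card_bij; first exact: dest_inj.
by rewrite !card_prod !card_bool !card_ord; lia.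
Qed.

Lemma sum_dest n (G : 'I_(4 * n) -> algC) :
  \sum_(q < 4 * n) G q = \sum_(y : bool * ('I_n * bool)) G (dest y).
Proof. by rewrite (reindex (@dest n)) //; apply/onW_bij/dest_bij. Qed.

Lemma sum_bool_pair (I : finType) (F : bool * I -> algC) :
  \sum_y F y = \sum_w F (true, w) + \sum_w F (false, w).
Proof.
transitivity (\sum_(y : bool * I) F (y.1, y.2)); first by apply: eq_bigr => -[].
by rewrite -(pair_bigA _ (fun b w => F (b, w))) /= big_bool.
Qed.

Lemma sum_pair_bool (I : finType) (F : I * bool -> algC) :
  \sum_y F y = \sum_w (F (w, true) + F (w, false)).
Proof.
transitivity (\sum_(y : I * bool) F (y.1, y.2)); first by apply: eq_bigr => -[].
by rewrite -(pair_bigA _ (fun w b => F (w, b))) /=; apply: eq_bigr => w _; rewrite big_bool.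
Qed.

(* The analyzer couples its modes 2p+1 and 2p+2 (cyclically); [anpair x] is the
   index p of the pair containing its mode [enc x]. *)
Definition anpair n (x : 'I_n * bool) : 'I_n := if x.2 then x.1 else ord_pred x.1.

Lemma ord_pred_val n (k : 'I_n) :
  ord_pred k = (if k == 0 :> nat then n.-1 else k.-1) :> nat.
Proof.
rewrite /=; have := ltn_ord k.
case: (posnP k) => [->|k0] kn; first by rewrite add0n modn_small; lia.
have -> : ((k + n).-1 = k.-1 + n)%N by lia.
by rewrite modnDr modn_small; lia.
Qed.

Lemma ord_pred_neq n (k : 'I_n) : (1 < n)%N -> ord_pred k != k.
Proof.
by move=> n1; rewrite -val_eqE [X in X == _]ord_pred_val /=; have := ltn_ord k;
  case: (@eqP _ (k : nat) 0%N); lia.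
Qed.

Section Entries.
Variables (n : nat) (n_gt1 : (1 < n)%N).
Implicit Types (x y : 'I_n * bool).

Local Notation S2 := (bs_layer (4 * n) (step2_pairs n)).
Local Notation S3 := (bs_layer (4 * n) (step3_pairs n)).
Local Notation AN := (bs_layer (4 * n) (analyzer_pairs n)).

Lemma step2_entry a x y : S2 (dest (a, y)) (enc x) =
  (~~ a && (y.1 == x.1))%:R * (-1) ^+ (x.2 && y.2) * s2inv.
Proof.
case: x => k b; have := ltn_ord k => kn; have ebn := enc_lt (k, b).
rewrite /step2_pairs (@bs_layer_on (4 * n) _ _ (iota 0 n) (k : nat)); last first.
- by rewrite /inpair /enc; case: b {ebn} => /=; lia.
- by move=> k1 k2 _ _ t; rewrite /inpair /= => *; lia.
- by lia.
- exact: (ltn_ord (dest (a,y))).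
- by rewrite mem_iota; lia.
- exact: iota_uniq.
case: y => q s; rewrite /hbs /enc /= -val_eqE /= /enc /=; have := ltn_ord q.
case: (@eqP _ (q : nat) k) => ?; case: a b s {ebn} => [] [] [] /= qn;
  rewrite ?(mul1r, mulr1, expr1, expr0);
  repeat (case: ifP => /eqP ?); rewrite ?(mul1r, mul0r, mulN1r) //; lia.
Qed.

Lemma step3_entry a x y : S3 (dest (a, y)) (enc x) = (y == x)%:R * s2inv.
Proof.
have xn := enc_lt x.
rewrite /step3_pairs (@bs_layer_on (4 * n) _ _ (iota 0 (2 * n)) (enc x)); last first.
- by rewrite /inpair eqxx.
- by move=> k1 k2; rewrite !mem_iota => ? ? t; rewrite /inpair /= => *; lia.
- by lia.
- exact: (ltn_ord (dest (a,y))).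
- by rewrite mem_iota; lia.
- exact: iota_uniq.
have yn := enc_lt y; rewrite /hbs /= eqxx -(inj_eq (@enc_inj n)).
case: (@eqP _ (enc y) (enc x)) => E; case: a => /=;
  repeat (case: ifP => /eqP ?); rewrite ?(mul1r, mul0r) //; lia.
Qed.

Lemma analyzer_entry_out (y : bool * ('I_n * bool)) x : AN (dest y) (enc x) = (y == (false, x))%:R.
Proof.
rewrite /analyzer_pairs bs_layer_off.
- rewrite -(inj_eq (@dest_inj n)) -val_eqE /= add0n; congr _%:R.
- by have := enc_lt x; lia.
- move=> k _; have := enc_lt x; rewrite /inpair /=; lia.
Qed.

Lemma anpair_enc x : (2 * n + (2 * anpair x).+1 == 2 * n + enc x)%N = x.2.
Proof. by rewrite /anpair /enc; case: x => q [] /=; lia. Qed.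

Lemma anpair_enc2 x :
  (2 * n + (2 * anpair x + 2) %% (2 * n) == 2 * n + enc x)%N = ~~ x.2.
Proof.
case: x => q s; rewrite /anpair /enc /=.
case: s => /=.
  have qn := ltn_ord q; have [q1|q1] := ltnP (q.+1) n.
    by rewrite modn_small; lia.
  (* The last pair closes the cycle: its second mode wraps around to analyzer mode 0. *)
  by have -> : (2 * q + 2 = 2 * n)%N by [lia]; rewrite modnn; lia.
have := ord_pred_val q => /= ->; have qn := ltn_ord q.
case: (@eqP _ (q : nat) 0%N) => q0; last by rewrite modn_small; lia.
by have -> : (2 * n.-1 + 2 = 2 * n)%N by [lia]; rewrite modnn; lia.
Qed.

Lemma analyzer_pair_inj k1 k2 t : (k1 < n)%N -> (k2 < n)%N ->
  let g k := (2 * n + (2 * k).+1, 2 * n + ((2 * k + 2) %% (2 * n)))%N in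
  inpair (g k1) t -> inpair (g k2) t -> k1 = k2.
Proof.
have E k : (k < n)%N -> ((2 * k + 2) %% (2 * n) = if k.+1 == n then 0 else 2 * k + 2)%N.
  move=> kn; case: eqP => ?; last by rewrite modn_small; lia.
  by have -> : (2 * k + 2 = 2 * n)%N by [lia]; rewrite modnn.
move=> k1n k2n; rewrite /inpair /= !E //.
by case: (@eqP _ k1.+1 n) => ?; case: (@eqP _ k2.+1 n) => ?; lia.
Qed.

Lemma analyzer_entry a x y : AN (dest (a, y)) (2 * n + enc x) =
  (a && (anpair y == anpair x))%:R * (-1) ^+ (~~ x.2 && ~~ y.2) * s2inv.
Proof.
have xn := enc_lt x; have yn := enc_lt y; pose p := anpair x.
rewrite /analyzer_pairs (@bs_layer_on (4 * n) _ _ (iota 0 n) (p : nat)); last first.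
- by rewrite /inpair /= -/p eq_sym anpair_enc eq_sym anpair_enc2; case: x.2.
- by move=> k1 k2; rewrite !mem_iota /= => ? ? t; apply: analyzer_pair_inj; lia.
- by lia.
- exact: (ltn_ord (dest (a,y))).
- by rewrite mem_iota; have := ltn_ord p; lia.
- exact: iota_uniq.
have A1 (z : 'I_n * bool) : (2 * n + enc z == 2 * n + (2 * anpair z).+1)%N = z.2.
  by rewrite eq_sym anpair_enc.
have A2 (z : 'I_n * bool) : (2 * n + enc z == 2 * n + (2 * anpair z + 2) %% (2 * n))%N = ~~ z.2.
  by rewrite eq_sym anpair_enc2.
rewrite /hbs /= A1 A2.
case: a => /=; last first.
  rewrite !mul0r; case: x.2; repeat (case: ifP => /eqP ?) => //; lia.
have [e|ne] := eqVneq (anpair y) p.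
  rewrite -e A1 A2.
  by case: x.2 y.2 => [] [] /=; rewrite ?(expr0, expr1, mul1r, mulN1r).
have {}ne t : inpair (2 * n + (2 * p).+1, 2 * n + ((2 * p + 2) %% (2 * n)))%N t ->
   inpair (2 * n + (2 * anpair y).+1, 2 * n + ((2 * anpair y + 2) %% (2 * n)))%N t -> False.
  move=> i1 i2; move/negP: ne; apply; rewrite -val_eqE; apply/eqP.
  by apply: (@analyzer_pair_inj _ _ t); rewrite ?ltn_ord.
have {}ne : ~~ inpair (2 * n + (2 * p).+1, 2 * n + ((2 * p + 2) %% (2 * n)))%N (2 * n + enc y).
  by apply/negP => /ne; apply; rewrite /inpair /= A1 A2; case: y.2.
move: ne; rewrite /inpair /= negb_or => /andP[/negbTE -> /negbTE ->].
by case: x.2; rewrite !mul0r.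
Qed.

(** Each layer crossed contributes [s2inv]. For a detected photon the two summands are the ways
    through rail 1 of its pair (sign from step (2)) and through rail 0 (sign from the analyzer); for
    an output photon the only sign comes from step (2). *)
Lemma Utot_entry (y : bool * ('I_n * bool)) x : Utot n (dest y) (mode x) =
  if y.1 then
    ((anpair y.2 == x.1)%:R * (-1) ^+ x.2
     + (anpair y.2 == ord_pred x.1)%:R * (-1) ^+ ~~ y.2.2) * s2inv ^+ 3
  else (y.2.1 == x.1)%:R * (-1) ^+ (x.2 && y.2.2) * s2inv ^+ 2.
Proof.
have step32 z : mcomp (4 * n) S3 S2 (dest z) (enc x) =
    (z.2.1 == x.1)%:R * (-1) ^+ (x.2 && z.2.2) * s2inv ^+ 2.
  case: z => a z; rewrite /mcomp sum_dest (bigD1 (false, z)) //= (step2_entry false) add0n step3_entry eqxx.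
  rewrite big1 ?addr0 => [|[[] w] neq]; first by rewrite /=; ring.
    by rewrite (step2_entry true) /= !mul0r mulr0.
  rewrite /= add0n (step3_entry a); case: eqP => [E|_]; last by rewrite !mul0r.
  by rewrite E eqxx in neq.
case: y => a y; rewrite -[nat_of_ord (mode x)]/(enc x) /Utot {1}/mcomp sum_dest.
under eq_bigr => z _ do rewrite step32.
have ANd (z w : bool * ('I_n * bool)) : AN (dest z) (dest w) = if w.1 then
    (z.1 && (anpair z.2 == anpair w.2))%:R * (-1) ^+ (~~ w.2.2 && ~~ z.2.2) * s2inv
    else (z == w)%:R.
  case: w => -[] w; case: z => c z; first exact: analyzer_entry.
  exact: (analyzer_entry_out (c, z) w).
under eq_bigr => z _ do rewrite ANd.
rewrite sum_bool_pair /= sum_pair_bool; case: a => /=.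
  rewrite [X in _ + X]big1 ?addr0 => [|w _]; last by rewrite mul0r.
  rewrite (bigD1 x.1) //= big1 ?addr0; last first.
    by move=> w /negbTE wx; rewrite wx !mul0r !mulr0 addr0.
  rewrite eqxx andbF andbT [anpair (x.1, true)]/= [anpair (x.1, false)]/=.
  by rewrite expr0 !(mul1r, mulr1); ring.
rewrite big1 ?add0r => [|w _]; last by rewrite !mul0r addr0.
rewrite (bigD1 y) //= eqxx mul1r big1 ?addr0 // => w neq.
by rewrite xpair_eqE /= eq_sym (negbTE neq) mul0r.
Qed.
End Entries.

(** * Hong-Ou-Mandel cancellation *)

Definition assignment n := {ffun 'I_n * bool -> bool * ('I_n * bool)}.

Definition hop n (x : 'I_n * bool) (y : bool * ('I_n * bool)) : algC :=
  if y.1 then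
    ((anpair y.2 == x.1)%:R * (-1) ^+ x.2
     + (anpair y.2 == ord_pred x.1)%:R * (-1) ^+ ~~ y.2.2) * s2inv ^+ 3
  else (y.2.1 == x.1)%:R * (-1) ^+ (x.2 && y.2.2) * s2inv ^+ 2.

Definition weight n (g : assignment n) : algC := \prod_x hop x (g x).

Definition mult n (lab : nat -> bool) (g : assignment n) y (b : bool) : nat :=
  #|[set x | (g x == y) && (lab (enc x) == b)]|.

Definition matches n (lab : nat -> bool) (g : assignment n) (c d : Cf n) : bool :=
  [forall x, forall b, (mult lab g (false, x) b == c (mode x, b)) &&
                       (mult lab g (true, x) b == d (mode x, b))].

Lemma half_lt n (t : 'I_(2 * n)) : (t./2 < n)%N.
Proof. by have := ltn_ord t; lia. Qed.

Definition pair_of n (t : 'I_(2 * n)) : 'I_n * bool := (Ordinal (half_lt t), odd t).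

Lemma pair_ofK n : cancel (@pair_of n) (@mode n).
Proof. by move=> t; apply: val_inj; rewrite /= /enc /=; lia. Qed.

Lemma modeK n : cancel (@mode n) (@pair_of n).
Proof. by move=> x; apply: mode_inj; rewrite pair_ofK. Qed.

Definition to_PA n (g : assignment n) : PA n := [ffun t => dest (g (pair_of t))].

Lemma to_PA_bij n : bijective (@to_PA n).
Proof.
apply: inj_card_bij.
  move=> g g' /ffunP E; apply/ffunP => x; have := E (mode x).
  by rewrite !ffunE modeK => /dest_inj.
rewrite !card_ffun !card_prod !card_ord !card_bool.
rewrite (_ : 4 * n = 2 * (n * 2))%N; last by lia.
by rewrite (mulnC n 2).
Qed.

Lemma prod_mode n (R : comPzSemiRingType) (F : 'I_(2 * n) -> R) :
  \prod_t F t = \prod_x F (mode x).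
Proof. by rewrite (reindex (@mode n)) //; apply/onW_bij/mode_bij. Qed.

Lemma prod_pair_bool (R : comPzSemiRingType) (I : finType) (F : I * bool -> R) :
  \prod_y F y = \prod_w (F (w, true) * F (w, false)).
Proof.
transitivity (\prod_(y : I * bool) F (y.1, y.2)); first by apply: eq_bigr => -[].
by rewrite -(pair_bigA _ (fun w b => F (w, b))) /=; apply: eq_bigr => w _; rewrite big_bool.
Qed.

Lemma occ_to_PA n lab (g : assignment n) y b : occ (to_PA g) lab (dest y) b = mult lab g y b.
Proof.
rewrite /occ /mult -(card_imset _ (@mode_inj n)); apply: eq_card => t.
rewrite -[t]pair_ofK (mem_imset _ _ (@mode_inj n)) !inE ffunE modeK.
by rewrite val_eqE (inj_eq (@dest_inj n)).
Qed.

Lemma compatible_to_PA n lab (g : assignment n) c d :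
  compatible (to_PA g) lab c d = matches lab g c d.
Proof.
apply/forallP/forallP => [H x|H [t b]].
  by apply/forallP => b; have := H (mode x, b); rewrite -(occ_to_PA _ _ (false, x))
    -(occ_to_PA _ _ (true, x)) /= add0n.
have /forallP/(_ b) := H (pair_of t); rewrite -(occ_to_PA _ _ (false, _))
    -(occ_to_PA _ _ (true, _)) /= add0n.
by rewrite pair_ofK -[enc _]/(val (mode (pair_of t))) pair_ofK.
Qed.

Section Hom.
Variables (n : nat) (n_gt1 : (1 < n)%N).
Implicit Types (x : 'I_n * bool) (y : bool * ('I_n * bool)) (g : assignment n).

Lemma ampE lab (c d : Cf n) :
  amp lab c d = sqrtC (fact_w c * fact_w d) * \sum_(g | matches lab g c d) weight g.
Proof.
rewrite /amp; congr (_ * _); rewrite (reindex (@to_PA n)) /=; last first.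
  exact/onW_bij/to_PA_bij.
under eq_bigl => g do rewrite compatible_to_PA.
apply: eq_bigr => g _; rewrite prod_mode; apply: eq_bigr => x _.
by rewrite ffunE modeK Utot_entry.
Qed.

(* The rail (0 or 1) a photon of input pair k must have taken to end up in y. *)
Definition rail (k : 'I_n) y : bool := if y.1 then anpair y.2 == k else y.2.2.

(** Rail 1 of pair [k] feeds analyzer pair [k], and rail 0 feeds analyzer pair [k - 1],
    cyclically. *)
Definition reach (k : 'I_n) y : bool :=
  if y.1 then (anpair y.2 == k) || (anpair y.2 == ord_pred k) else y.2.1 == k.

Lemma hop_reach x y : hop x y != 0 -> reach x.1 y.
Proof.
rewrite /hop /reach; case: y => [[] z] /=.
  case: (anpair z == x.1) => //=; case: (anpair z == ord_pred x.1) => //=.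
  by rewrite !mul0r addr0 mul0r eqxx.
by case: (z.1 == x.1) => //=; rewrite !mul0r eqxx.
Qed.

(** Only step (2) distinguishes the two inputs of a pair, by a minus sign on rail 1. The destination
    fixes the rail because the analyzer pairs [k] and [ord_pred k] differ. *)
Lemma hop_sign k b y : hop (k, b) y = (-1) ^+ (b && rail k y) * hop (k, false) y.
Proof.
rewrite /hop /rail; case: y => [[] z] /=; last by rewrite ?expr0; ring.
case: (eqVneq (anpair z) k) => [->|_].
  by rewrite eq_sym (negbTE (ord_pred_neq k n_gt1)) andbT !mul0r !addr0 !mul1r ?expr0 ?mul1r.
by rewrite andbF expr0 mul1r !mul0r.
Qed.

Definition exchange (k : 'I_n) g : assignment n :=
  [ffun x => g (if x.1 == k then (k, ~~ x.2) else x)].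

Lemma exchangeK k : involutive (exchange k).
Proof.
move=> g; apply/ffunP => -[q b]; rewrite !ffunE /=.
by case: (eqVneq q k) => [->|/negbTE nq]; rewrite /= ?eqxx ?negbK ?nq.
Qed.

Definition same_rail k g := rail k (g (k, false)) == rail k (g (k, true)).

(** Relative to [(k, false)], the photon [(k, true)] picks up a sign exactly on rail 1; when the
    rails differ, this happens in exactly one of the two orders. *)
Lemma weight_exchange k g : ~~ same_rail k g -> weight (exchange k g) = - weight g.
Proof.
move=> bad; rewrite /weight !prod_pair_bool (bigD1 k) //= [in RHS](bigD1 k) //=.
rewrite -mulNr; congr (_ * _); last first.
  by apply: eq_bigr => q /negbTE nq; rewrite !ffunE /= nq.
rewrite !ffunE /= eqxx !(hop_sign k true).
move: bad; rewrite /same_rail; case: (rail k (g (k, false))); case: (rail k (g (k, true))) => //= _;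
  by rewrite ?(expr0, expr1); ring.
Qed.

Lemma same_rail_exchange k k' g : same_rail k' (exchange k g) = same_rail k' g.
Proof.
rewrite /same_rail !ffunE /=; case: (eqVneq k' k) => [->|//].
exact: eq_sym.
Qed.

Lemma mult_exchange lab k g y b : lab (enc (k, false)) = lab (enc (k, true)) ->
  mult lab (exchange k g) y b = mult lab g y b.
Proof.
move=> Elab; pose s x := if x.1 == k then (k, ~~ x.2) else x.
have sK : involutive s.
  case=> q c; rewrite /s /=; case: (eqVneq q k) => [->|/negbTE nq] /=; rewrite ?eqxx ?negbK //.
  by rewrite nq.
rewrite /mult -(card_imset _ (inv_inj sK)); apply: eq_card => x.
rewrite -[x]sK (mem_imset _ _ (inv_inj sK)) !inE ffunE -/(s _) sK.
congr (_ && (_ == _)); case: x => q c; rewrite /s /=.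
by case: eqP => // ->; case: c; rewrite ?Elab.
Qed.

Lemma matches_exchange lab k g c d : lab (enc (k, false)) = lab (enc (k, true)) ->
  matches lab (exchange k g) c d = matches lab g c d.
Proof.
by move=> E; apply: eq_forallb => x; apply: eq_forallb => b; rewrite !mult_exchange.
Qed.

(* Hong-Ou-Mandel: photons of one input pair that are indistinguishable and
   take different rails cancel against the assignment where they are exchanged. *)
Lemma hom_cancel lab (c d : Cf n) (ks : seq 'I_n) :
  {in ks, forall k, lab (enc (k, false)) = lab (enc (k, true))} ->
  \sum_(g | matches lab g c d) weight g =
  \sum_(g | matches lab g c d && all (same_rail^~ g) ks) weight g.
Proof.
elim: ks => [|k ks IH] labE; first by apply: eq_bigl => g; rewrite andbT.
rewrite IH => [|k' k'ks]; last by apply: labE; rewrite in_cons k'ks orbT.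
rewrite (bigID (same_rail k)) /= [X in _ + X](_ : _ = 0) ?addr0.
  by apply: eq_bigl => g; rewrite andbAC andbA.
(* The exchange turns the sum over assignments with different rails in pair [k] into its own
   negative, so twice this sum is zero. *)
apply/eqP; rewrite -(eqr_pMn2r (n := 2)) // mul0rn mulr2n addr_eq0; apply/eqP.
rewrite {1}(reindex_inj (inv_inj (exchangeK k))) /= -sumrN.
apply: eq_big => [g|g /andP[_ bad]]; last first.
  by rewrite weight_exchange // -(same_rail_exchange k).
rewrite same_rail_exchange matches_exchange; last by apply: labE; exact: mem_head.
by under eq_all => k' do rewrite same_rail_exchange.
Qed.

End Hom.

(** * Heralded assignments *)

Lemma cvE n (c : Cf n) q b : cv c (enc q) b = c (mode q, b).
Proof.
by rewrite /cv (big_pred1 (mode q, b)) // => -[t b'].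
Qed.

Lemma card_pair_bool (I : finType) (P : pred (I * bool)) :
  #|[set x | P x]| = (\sum_k (P (k, false) + P (k, true)))%N.
Proof.
rewrite -sum1_card big_mkcond /=.
transitivity (\sum_(y : I * bool) P (y.1, y.2) : nat)%N.
  by apply: eq_bigr => -[k b] _; rewrite inE; case: (P _).
rewrite -(pair_bigA _ (fun w b => P (w, b) : nat)) /=; apply: eq_bigr => w _.
by rewrite big_bool addnC.
Qed.

(** The iterates of the cyclic successor run through all indices; [k'] is reached from [k] after
    [k' + n - k] steps. *)
Lemma ordS_invariant n (s : pred 'I_n) :
  (forall k, s k -> s (ordS k)) -> forall k k', s k -> s k'.
Proof.
move=> sS k k' sk.
have it j : s (iter j (@ordS n) k) by elim: j => //= j; apply: sS.
have itE j : val (iter j (@ordS n) k) = ((k + j) %% n)%N.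
  elim: j => [|j /= ->]; first by rewrite addn0 modn_small.
  by rewrite -addn1 modnDml addn1 addnS.
have := it (k' + n - k)%N; congr (is_true (s _)); apply: val_inj; rewrite itE.
have := ltn_ord k; have := ltn_ord k' => lt' lt.
by rewrite subnKC ?modnDr ?modn_small //; lia.
Qed.

(** The mode of analyzer pair [p] that fires in a heralded pattern: the odd mode [2p+1] if it
    registers one photon, otherwise its partner [2p+2], which is [(ordS p, false)]. *)
Definition click n (m : nat -> nat) (p : 'I_n) : 'I_n * bool :=
  let o := m (2 * p).+1 == 1%N in (if o then p else ordS p, o).

Lemma anpair_click n m (p : 'I_n) : anpair (click m p) = p.
Proof. by rewrite /anpair /click /=; case: eqP; rewrite ?ordSK. Qed.

(** For [z = (s, t, e)]: [s] is the rail of all detected photons and of the output photons outside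
    pair [i], [t] is the rail of the output photon of pair [i], and [e k] says which input of pair
    [k] is detected. *)
Definition canon n (m : nat -> nat) (i : 'I_n) (z : bool * bool * {ffun 'I_n -> bool}) : assignment n :=
  [ffun x => if x.2 == z.2 x.1
             then (true, click m (if z.1.1 then x.1 else ord_pred x.1))
             else (false, (x.1, if x.1 == i then z.1.2 else z.1.1))].

Section Structure.
Variables (n : nat) (n_gt1 : (1 < n)%N) (m : nat -> nat) (succ_m : success n m).
Implicit Types (x q : 'I_n * bool) (y : bool * ('I_n * bool)) (g : assignment n).

Lemma success_click q : m (enc q) = (q == click m (anpair q)) :> nat.
Proof.
have /forallP/(_ (anpair q))/eqP := succ_m.
have -> : ((2 * anpair q + 2) %% (2 * n) = enc (ordS (anpair q), false))%N.
  by rewrite /enc /= addn0 muln_modr; congr (_ %% _)%N; lia.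
rewrite /click; case: q => q [].
  rewrite /anpair /= /enc /= addn1 => mE; case: (@eqP _ (m _) 1%N) => [->|ne]; first by rewrite eqxx.
  by rewrite xpair_eqE andbF; lia.
rewrite /anpair [(q, false).2]/= [(q, false).1]/= ord_predK => mE.
case: (@eqP _ (m (_.+1)) 1%N) => [m1|ne]; first by rewrite xpair_eqE andbF; lia.
by rewrite eqxx; lia.
Qed.

Lemma mult_total lab g y :
  (mult lab g y false + mult lab g y true = #|[set x | g x == y]|)%N.
Proof.
rewrite addnC -(cardsID [set x | lab (enc x)] [set x | g x == y]).
by congr (_ + _)%N; apply: eq_card => x; rewrite !inE ?eqb_id ?eqbF_neg // andbC.
Qed.

Section Path.
Variables (lab : nat -> bool) (g : assignment n) (c d : Cf n).
Hypotheses (match_g : matches lab g c d) (meas_d : meas_ok m d).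

Lemma card_measured q : #|[set x | g x == (true, q)]| = m (enc q).
Proof.
rewrite -(mult_total lab).
have /forallP/(_ q)/forallP H := match_g.
have /andP[_ /eqP ->] := H false; have /andP[_ /eqP ->] := H true.
by have /forallP/(_ (mode q))/eqP := meas_d.
Qed.

Lemma measured_click x q : g x = (true, q) -> q = click m (anpair q).
Proof.
move=> gx; apply/eqP; have := card_measured q; rewrite success_click.
case: (q == _) => // /eqP; rewrite cards_eq0 => /eqP/setP/(_ x).
by rewrite !inE gx eqxx.
Qed.

Lemma click_measured p : exists2 x, g x = (true, click m p) &
  forall x', g x' = (true, click m p) -> x' = x.
Proof.
have := card_measured (click m p); rewrite success_click anpair_click eqxx.
move=> /eqP/cards1P[x /setP E]; exists x.
  by apply/eqP; have := E x; rewrite !inE eqxx.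
by move=> x' gx'; apply/eqP; have := E x'; rewrite !inE gx' eqxx.
Qed.

Lemma click_inj x x' p : g x = (true, click m p) -> g x' = (true, click m p) -> x = x'.
Proof. by have [z _ H] := click_measured p; move=> /H -> /H ->. Qed.

Hypothesis reach_g : forall x, reach x.1 (g x).

(** The rail fixes the analyzer pair, and only one mode of that pair fires. *)
Lemma measured_at x : (g x).1 ->
  g x = (true, click m (if rail x.1 (g x) then x.1 else ord_pred x.1)).
Proof.
have := reach_g x; case E: (g x) => [[] q] //=; rewrite /reach /rail /= => rq _.
rewrite {1}(measured_click E); case: eqP rq => [-> //|_ /= /eqP -> //].
Qed.

(** By [reach_g], the photons in output pair [k] come from input pair [k]; the dual-rail condition
    leaves exactly one of them there. *)
Lemma single_output_dr (k : 'I_n) : dr_conf c -> (g (k, false)).1 != (g (k, true)).1.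
Proof.
move=> /forallP/(_ k).
have -> : (2 * k).+1 = enc (k, true) by rewrite /enc addn1.
have -> : (2 * k)%N = enc (k, false) by rewrite /enc addn0.
rewrite !cvE.
have /forallP H := match_g.
have /forallP/(_ false)/andP[/eqP <- _] := H (k, false).
have /forallP/(_ true)/andP[/eqP <- _] := H (k, false).
have /forallP/(_ false)/andP[/eqP <- _] := H (k, true).
have /forallP/(_ true)/andP[/eqP <- _] := H (k, true).
rewrite mult_total -addnA mult_total -cardsUI (_ : _ :&: _ = set0); last first.
  by apply/setP => x; rewrite !inE; case: eqP => // ->; rewrite !xpair_eqE /= andbF.
rewrite cards0 addn0.
rewrite (_ : _ :|: _ = [set x | ~~ (g x).1 && (x.1 == k)]); last first.
  apply/setP => x; rewrite !inE; have := reach_g x; rewrite /reach.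
  case: (g x) => [[] [q s]] //=; rewrite !xpair_eqE /= => /eqP ->.
  by rewrite -andb_orr; case: s; rewrite ?andbT.
rewrite card_pair_bool (bigD1 k) //= big1 => [|k' /negbTE ->]; last by rewrite !andbF.
by rewrite eqxx !andbT; case: (g _).1 (g _).1 => [] [].
Qed.

(** This replaces the dual-rail condition when every pair keeps its photons on one rail: all pairs
    then use the same rail, so each analyzer pair is fed by a single input pair and its click takes
    one of the two photons. *)
Lemma single_output_rail (k : 'I_n) : (forall k, same_rail k g) ->
  (g (k, false)).1 != (g (k, true)).1.
Proof.
move=> same; pose s k := rail k (g (k, false)).
have sE k' b : rail k' (g (k', b)) = s k' by case: b => //; rewrite -(eqP (same k')).
have sS k1 k2 : s k1 = s k2.
  suff H : forall k, ~~ s k -> ~~ s (ordS k).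
    apply: negb_inj; apply/idP/idP; exact: (@ordS_invariant _ (fun k => ~~ s k)).
  (* Analyzer pair [k'] is fed by rail 1 of pair [k'] and rail 0 of pair [ordS k']; if neither is
     used, no photon causes its click. *)
  move=> k' /negbTE sk'; apply/negP => sSk'.
  have [[q b] gq _] := click_measured k'.
  have := @measured_at (q, b); rewrite /= sE gq => /(_ isT) /(congr1 (fun y => anpair y.2)).
  rewrite /= !anpair_click; case: ifP => sq E; first by rewrite E sq in sk'.
  by rewrite E ord_predK sq in sSk'.
have [[q b] gq uq] := click_measured (if s k then k else ord_pred k).
have Ek : q = k.
  have := @measured_at (q, b); rewrite /= sE gq => /(_ isT) /(congr1 (fun y => anpair y.2)).
  by rewrite /= !anpair_click (sS q k) /=; case: (s k) => [->|/ord_pred_inj ->].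
subst q; have Hb b' : (g (k, b')).1 -> b' = b.
  move=> gb'; have := measured_at gb'; rewrite sE => /uq [] //.
have gb : (g (k, b)).1 by rewrite gq.
have gNb : ~~ (g (k, ~~ b)).1 by apply/negP => /Hb; case: (b).
by case: b gb gNb {gq uq Hb} => /= -> /negbTE ->.
Qed.

Lemma canonP (i : 'I_n) : (forall k, (g (k, false)).1 != (g (k, true)).1) ->
  (forall k, k != i -> same_rail k g) -> exists z, g = canon m i z.
Proof.
move=> single same; pose e := [ffun k => (g (k, true)).1]; pose s k := rail k (g (k, e k)).
have e1 k b : (g (k, b)).1 = (b == e k).
  by rewrite ffunE; have := single k; case: b; case: (g _).1 (g _).1 => [] [].
have gE k b : b == e k -> g (k, b) = (true, click m (if s k then k else ord_pred k)).
  by move=> Eb; rewrite measured_at ?e1 //= /s -(eqP Eb).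
have sS k1 k2 : s k1 = s k2.
  suff H : forall k, s k -> s (ordS k) by apply/idP/idP; exact: ordS_invariant.
  (* Detected photons on rail 1 of pair [k] and on rail 0 of pair [ordS k] would both land in the
     clicked mode of analyzer pair [k], which holds one photon. *)
  move=> k sk; apply: contraT => sSk.
  have := gE (ordS k) _ (eqxx _); rewrite (negbTE sSk) ordSK => g1.
  have := gE k _ (eqxx _); rewrite sk => g2.
  have [kk _] := click_inj g1 g2.
  by have := ord_pred_neq k n_gt1; rewrite -{2}kk -{1}kk ordSK kk eqxx.
(* The first two components are the rails of the detected and of the remaining photon of pair [i];
   in the other pairs [same_rail] makes these rails equal. *)
exists (s i, rail i (g (i, ~~ e i)), e); apply/ffunP => -[k b]; rewrite [RHS]ffunE /=.
case: ifP => Eb; first by rewrite gE // (sS k i).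
have := reach_g (k, b); have := e1 k b; rewrite Eb.
have {}Eb : b = ~~ e k by move: Eb; case: b (e k) => [] [].
case G: (g (k, b)) => [[] [q t]] //= _; rewrite /reach /= => /eqP ->.
congr (_, (_, _)); case: eqP => [ki|/eqP ki]; first by rewrite -ki -Eb G.
rewrite (sS i k) /s; have := same k ki; rewrite /same_rail.
by have := G; rewrite Eb; case: (e k) => /= ->; rewrite /rail /= => /eqP.
Qed.

End Path.
End Structure.

(** * Amplitudes of the heralded assignments *)

Definition outconf n (i : 'I_n) (s t l : bool) : Cf n :=
  drket n (fun k => if k == i then t else s) (fun k => (k == i) && l).

(* The detected configuration: one photon in each clicked analyzer mode, the
   only one possibly in state psi1 being the one that came from input pair i. *)
Definition clickconf n (m : nat -> nat) (i : 'I_n) (s l : bool) : Cf n :=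
  [ffun x : 'I_(2 * n) * bool => inord ((m x.1 == 1%N) &&
     (x.2 == (l && (anpair (pair_of x.1) == if s then i else ord_pred i))))].

Lemma nat_of_inord_bool n (b : bool) : (0 < n)%N -> (inord b : 'I_n.+1) = b :> nat.
Proof. by move=> n0; rewrite inordK //; case: b; rewrite ltnS. Qed.

Section Canon.
Variables (n : nat) (n_gt1 : (1 < n)%N) (m : nat -> nat) (succ_m : success n m) (i : 'I_n).
Implicit Types (x q : 'I_n * bool) (y : bool * ('I_n * bool)).

Let n2_gt0 : (0 < 2 * n)%N. Proof. by rewrite muln_gt0 (ltnW n_gt1). Qed.

Lemma outconfE s t l k r b :
  outconf i s t l (mode (k, r), b) =
  (r == if k == i then t else s) && (b == (k == i) && l) :> nat.
Proof.
clear m succ_m; rewrite ffunE nat_of_inord_bool // [(_, _).1]/= [(_, _).2]/=.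
have -> : nat_of_ord (mode (k, r)) = (k.*2 + r)%N by rewrite /= /enc mul2n.
have -> : odd (k.*2 + r) = r by rewrite oddD odd_double; case: (r).
by have -> : ((k.*2 + r)./2 = k)%N by [case: (r); lia].
Qed.

Lemma clickconfE s l q b :
  clickconf m i s l (mode q, b) =
  (q == click m (anpair q)) &&
  (b == (l && (anpair q == if s then i else ord_pred i))) :> nat.
Proof.
rewrite ffunE nat_of_inord_bool // [(_, _).1]/= [(_, _).2]/= modeK.
by rewrite [m _](success_click n_gt1 succ_m); case: (q == _).
Qed.

Lemma fact_outconf s t l : fact_w (outconf i s t l) = 1.
Proof.
by apply: big1 => x _; rewrite ffunE nat_of_inord_bool //; case: (_ && _).
Qed.

Lemma fact_clickconf s l : fact_w (clickconf m i s l) = 1.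
Proof.
by apply: big1 => x _; rewrite ffunE nat_of_inord_bool //; case: (_ && _).
Qed.

Lemma rail_canon s t e k b : rail k (canon m i (s, t, e) (k, b)) =
  if b == e k then s else if k == i then t else s.
Proof.
rewrite ffunE /=; case: ifP => // _; rewrite /rail /= anpair_click.
by case: s; rewrite ?eqxx // (negbTE (ord_pred_neq k n_gt1)).
Qed.

Lemma same_rail_canon s t e k :
  same_rail k (canon m i (s, t, e)) = ((k == i) ==> (s == t)).
Proof.
rewrite /same_rail !rail_canon.
by case: (e k); case: (k == i); rewrite //= ?eqxx // eq_sym.
Qed.

(** The detected photons give [e], the output photon of pair [i] gives [t], and that of another
    pair, here [ord_pred i], gives [s]. *)
Lemma canon_inj : injective (canon m i).
Proof.
move=> [[s t] e] [[s' t'] e'] /ffunP E.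
have Ee : e = e'.
  apply/ffunP => k; have := E (k, e k); rewrite !ffunE /= eqxx.
  by case: eqP.
subst e'; congr (_, _, _).
  have := E (ord_pred i, ~~ e (ord_pred i)); rewrite !ffunE /=.
  rewrite (negbTE (ord_pred_neq i n_gt1)) (_ : _ == _ = false); last by case: (e _).
  by case.
have := E (i, ~~ e i); rewrite !ffunE /= eqxx (_ : _ == _ = false); last by case: (e _).
by case.
Qed.

Section Labels.
Variables (lab : nat -> bool) (lb : bool -> bool).
Hypothesis labE : forall k b, lab (enc (k, b)) = (k == i) && lb b.

Lemma mult_canon_out s t e k r b :
  mult lab (canon m i (s, t, e)) (false, (k, r)) b =
  outconf i s t (lb (~~ e i)) (mode (k, r), b).
Proof.
rewrite outconfE /mult card_pair_bool (bigD1 k) //= big1 => [|k' /negbTE nk].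
  rewrite !ffunE /= !labE.
  case: (eqVneq k i) => [->|_]; case: (e _) => /=; rewrite ?xpair_eqE ?eqxx /=;
  by rewrite !(eq_sym r) !(eq_sym b) !addn0.
have H b' : (canon m i (s, t, e) (k', b') == (false, (k, r))) = false.
  by rewrite ffunE /=; case: (b' == _); rewrite // !xpair_eqE nk.
by rewrite !H.
Qed.

Lemma mult_canon_click s t e q b :
  mult lab (canon m i (s, t, e)) (true, q) b =
  clickconf m i s (lb (e i)) (mode q, b).
Proof.
rewrite clickconfE /mult card_pair_bool.
pose k := if s then anpair q else ordS (anpair q).
rewrite (bigD1 k) //= big1 => [|k' /negbTE nk].
  rewrite !ffunE /= !labE.
  have -> : (if s then k else ord_pred k) = anpair q.
    by rewrite /k; case: (s); rewrite ?ordSK.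
  have -> : (anpair q == if s then i else ord_pred i) = (k == i).
    rewrite /k; case: (s) => //.
    by rewrite -(inj_eq (@ordS_inj n)) ord_predK.
  case: (eqVneq k i) => [->|_]; case: (e _) => /=; rewrite ?xpair_eqE ?eqxx /= ?andbT ?andbF;
  by rewrite !(eq_sym q) !(eq_sym b) ?addn0.
have H b' : (canon m i (s, t, e) (k', b') == (true, q)) = false.
  rewrite ffunE /=; case: ifP => _ //; rewrite xpair_eqE /=.
  apply/eqP => /(congr1 (@anpair n)); rewrite anpair_click /k in nk *.
  case: (s) nk => [nk E|nk E]; first by rewrite E eqxx in nk.
  by rewrite -E ord_predK eqxx in nk.
by rewrite !H.
Qed.

(** Only the photons of pair [i] may be in psi1. Its photon [e i] is detected and carries its label
    to the analyzer; the label of [~~ e i] appears in the output. *)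
Lemma matches_canon s t e c d : matches lab (canon m i (s, t, e)) c d =
  (c == outconf i s t (lb (~~ e i))) && (d == clickconf m i s (lb (e i))).
Proof.
apply/forallP/andP => [H|[/eqP -> /eqP ->] [k r]].
  split; apply/eqP/ffunP => -[x b]; rewrite -[x]pair_ofK; apply: val_inj;
    have /forallP/(_ b)/andP[/eqP h1 /eqP h2] := H (pair_of x).
    by rewrite /= -h1; case: (pair_of x) => k r; rewrite mult_canon_out.
  by rewrite /= -h2 mult_canon_click.
by apply/forallP => b; rewrite mult_canon_out mult_canon_click !eqxx.
Qed.

End Labels.

(** Under success [s_odd] is the number of analyzer pairs that fire in their odd mode. *)
Lemma sign_s_odd : \prod_(p < n) (-1) ^+ (m (2 * p).+1 == 1%N) = (-1) ^+ s_odd n m :> algC.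
Proof.
rewrite -expr_sum /s_odd [in RHS]big_mkcond [in RHS](reindex (@mode n)) /=; last first.
  exact/onW_bij/mode_bij.
congr (_ ^+ _); transitivity (\sum_(x : 'I_n * bool) (if x.2 then (m (2 * x.1).+1 == 1) : nat else 0))%N.
  rewrite -(pair_bigA _ (fun (w : 'I_n) b => if b then (m (2 * w).+1 == 1)%N : nat else 0%N)) /=.
  apply: eq_bigr => p _; rewrite big_bool; exact: (esym (addn0 _)).
apply: eq_bigr => -[p b] _ /=; rewrite /enc /= oddD mul2n odd_double.
case: b => //=; rewrite -mul2n -[(2 * p + 1)%N]/(enc (p, true)) -addn1 -[(2 * p + 1)%N]/(enc (p, true)).
by rewrite success_click //; case: (_ == click _ _).
Qed.

(** A pair contributes [s2inv ^+ 3] for its detected and [s2inv ^+ 2] for its output photon. On rail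
    1 the sign of step (2) occurs once per pair, whichever input is detected; on rail 0 the signs
    come from the analyzer and multiply up to the parity of [s_odd]. A deviating [t] changes only
    the sign of the output photon of pair [i]. *)
Lemma weight_canon s t e : weight (canon m i (s, t, e)) =
  (- s2inv ^+ 5) ^+ n *
  ((-1) ^+ (~~ e i && (t (+) s)) * (if s then 1 else (-1) ^+ s_odd n m)).
Proof.
have step k : hop (k, true) (canon m i (s, t, e) (k, true))
      * hop (k, false) (canon m i (s, t, e) (k, false)) =
    (- s2inv ^+ 5) * ((if s then 1 else (-1) ^+ (m (2 * ord_pred k).+1 == 1%N))
      * (if k == i then (-1) ^+ (~~ e i && (t (+) s)) else 1)).
  have pk : (ord_pred k == k) = false by apply/negbTE/ord_pred_neq.
  have kp : (k == ord_pred k) = false by rewrite eq_sym.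
  rewrite !ffunE /hop /=.
  rewrite /= !(eq_sym _ (e k)); case: (eqVneq k i) => [<-|_];
    case: (e k); case: s; rewrite /= !anpair_click ?eqxx ?pk ?kp;
    case: (_ == 1%N); case: t => /=; rewrite ?(expr0, expr1); ring.
rewrite /weight prod_pair_bool; under eq_bigr => k _ do rewrite step.
rewrite !big_split /= prodr_const card_ord; congr (_ * _); rewrite mulrC; congr (_ * _).
  by rewrite (bigD1 i) //= eqxx big1 ?mulr1 // => k /negbTE ->.
case: (s); first by rewrite big1.
rewrite -sign_s_odd [RHS](reindex (@ord_pred n)) //.
exact/onW_bij/ord_pred_bij.
Qed.

End Canon.

(** * The heralded output state *)

(** Flipping the value at [i] matches the functions with [e i] true with those with [e i] false, so
    both classes have the same size. *)
Lemma sum_ffun_at n (i : 'I_n) (F : bool -> algC) :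
  \sum_(e : {ffun 'I_n -> bool}) F (e i) =
  #|[set e : {ffun 'I_n -> bool} | e i]|%:R * \sum_b F b.
Proof.
pose flip (e : {ffun 'I_n -> bool}) : {ffun 'I_n -> bool} := [ffun k => (k == i) (+) e k].
have flipK : involutive flip by move=> e; apply/ffunP => k; rewrite !ffunE addbA addbb.
rewrite (bigID (fun e : {ffun 'I_n -> bool} => e i)) /=.
have sumE b : \sum_(e : {ffun 'I_n -> bool} | e i == b) F (e i) =
    #|[set e : {ffun 'I_n -> bool} | e i == b]|%:R * F b.
  under eq_bigr => e /eqP -> do [].
  by rewrite sumr_const mulr_natl; congr (_ *+ _); apply: eq_card => e; rewrite inE.
have -> : \sum_(e : {ffun 'I_n -> bool} | e i) F (e i) =
    #|[set e : {ffun 'I_n -> bool} | e i]|%:R * F true.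
  under eq_bigl => e do rewrite -[e i]eqb_id.
  by rewrite sumE; congr (_%:R * _); apply: eq_card => e; rewrite !inE eqb_id.
under [X in _ + X]eq_bigl => e do rewrite -eqbF_neg.
rewrite sumE big_bool mulrDr; congr (_ + _%:R * _).
rewrite -(card_imset _ (inv_inj flipK)); apply: eq_card => e.
by rewrite -[e]flipK (mem_imset _ _ (inv_inj flipK)) !inE !ffunE eqxx /= negbK; case: (e i).
Qed.

Section Amplitude.
Variables (n : nat) (n_gt1 : (1 < n)%N) (m : nat -> nat) (succ_m : success n m) (i : 'I_n).

(** The factor common to all paths; the cardinality counts the choices of the detected photon in the
    pairs other than [i]. *)
Definition gain : algC :=
  (- s2inv ^+ 5) ^+ n * #|[set e : {ffun 'I_n -> bool} | e i]|%:R.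

Definition path_sign (s t b : bool) : algC :=
  (-1) ^+ (~~ b && (t (+) s)) * (if s then 1 else (-1) ^+ s_odd n m).

Lemma s2inv_neq0 : s2inv != 0.
Proof. by rewrite invr_eq0 sqrtC_eq0 pnatr_eq0. Qed.

Lemma gain_neq0 : gain != 0.
Proof.
rewrite mulf_neq0 // ?expf_eq0 ?oppr_eq0 ?expf_eq0 ?(negbTE s2inv_neq0) ?andbF //.
rewrite pnatr_eq0 -lt0n; apply/card_gt0P; exists [ffun=> true].
by rewrite inE ffunE.
Qed.

Section Labels.
Variables (lab : nat -> bool) (lb : bool -> bool).
Hypothesis labE : forall k b, lab (enc (k, b)) = (k == i) && lb b.
Let same := lb false == lb true.

(** One output photon per pair is ensured either by the dual-rail condition on [c] or by equal
    labels in pair [i]; in the latter case the Hong-Ou-Mandel cancellation reaches pair [i] too and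
    leaves only [s = t]. *)
Lemma sum_weight_canon (c d : Cf n) : meas_ok m d -> dr_conf c || same ->
  \sum_(g | matches lab g c d) weight g =
  \sum_(z : bool * bool * {ffun 'I_n -> bool} |
     [&& c == outconf i z.1.1 z.1.2 (lb (~~ z.2 i)), d == clickconf m i z.1.1 (lb (z.2 i))
       & same ==> (z.1.1 == z.1.2)]) weight (canon m i z).
Proof.
move=> meas_d dr_or_same; pose ks := [seq k <- enum 'I_n | (k != i) || same].
have ksP k : k \in ks = (k != i) || same by rewrite mem_filter mem_enum andbT.
rewrite (@hom_cancel _ n_gt1 _ _ _ ks) => [|k]; last first.
  by rewrite ksP !labE; case: (eqVneq k i) => //= _ /eqP.
pose P g := matches lab g c d && all (fun k => same_rail k g) ks.
have PE z : P (canon m i z) = [&& c == outconf i z.1.1 z.1.2 (lb (~~ z.2 i)),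
     d == clickconf m i z.1.1 (lb (z.2 i)) & same ==> (z.1.1 == z.1.2)].
  case: z => [[s t] e]; rewrite /P (matches_canon n_gt1 succ_m labE) -andbA; congr [&& _, _ & _].
  apply/allP/implyP => [H Hs|H k].
    by have := H i; rewrite ksP eqxx Hs (same_rail_canon n_gt1) eqxx => /(_ isT).
  by rewrite ksP (same_rail_canon n_gt1); case: (eqVneq k i).
have imP g : P g -> weight g != 0 -> exists z, g = canon m i z.
  move=> /andP[match_g /allP same_g] wg.
  have reach_g (x : 'I_n * bool) : reach x.1 (g x) by apply: hop_reach; apply: contraNneq wg => w0;
    rewrite /weight (bigD1 x) //= w0 mul0r.
  apply: (canonP n_gt1 succ_m match_g meas_d reach_g) => [k|k ki]; last first.
    by apply: same_g; rewrite ksP ki.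
  case/orP: dr_or_same => [dr|Hs].
    exact: (single_output_dr match_g reach_g).
  apply: (single_output_rail n_gt1 succ_m match_g meas_d reach_g) => k'.
  by apply: same_g; rewrite ksP Hs orbT.
under [RHS]eq_bigl => z do rewrite -PE.
(* The canonical form is established for nonzero weights only, so zero terms are dropped on both
   sides before the sums are matched. *)
rewrite (bigID (fun g => weight g == 0)) /= big1 ?add0r => [|g /andP[_ /eqP //]].
rewrite [RHS](bigID (fun z => weight (canon m i z) == 0)) /= [X in _ = X + _]big1 ?add0r;
  last by move=> z /andP[_ /eqP].
pose A := [set z | P (canon m i z) && (weight (canon m i z) != 0)].
rewrite [RHS](eq_bigl (fun z => z \in A)) => [|z]; last by rewrite inE.
rewrite -(big_imset (fun g => weight g) (h := canon m i)) /=; last first.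
  by move=> z z' _ _; apply: (canon_inj n_gt1).
apply: eq_bigl => g; apply/andP/imsetP => [[Pg wg]|[z]].
  by have [z Ez] := imP g Pg wg; exists z => //; rewrite inE -Ez wg andbT; exact: Pg.
by rewrite inE => /andP[Pz wz] ->.
Qed.

Definition path_amp (s t b : bool) : algC := ((same ==> (s == t)) : nat)%:R * path_sign s t b.

Lemma amp_canon (c d : Cf n) : meas_ok m d -> dr_conf c || same ->
  amp lab c d = gain * \sum_s \sum_t \sum_b path_amp s t b *
     (c == outconf i s t (lb (~~ b)))%:R * (d == clickconf m i s (lb b))%:R.
Proof.
move=> meas_d dr; rewrite ampE // sum_weight_canon // mulr_sumr big_mkcond /=.
pose F s t b := (- s2inv ^+ 5) ^+ n * (path_amp s t b *
     (c == outconf i s t (lb (~~ b)))%:R * (d == clickconf m i s (lb b))%:R).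
transitivity (\sum_(z : bool * bool * {ffun 'I_n -> bool}) F z.1.1 z.1.2 (z.2 i)).
  apply: eq_bigr => -[[s t] e] _ /=; rewrite weight_canon // /F /path_amp /path_sign.
  case: eqP => [->|_]; last by rewrite !(mulr0, mul0r).
  case: eqP => [->|_]; last by rewrite !(mulr0, mul0r).
  case: (_ ==> _) => /=; last by rewrite !(mulr0, mul0r).
  by rewrite fact_outconf // fact_clickconf // mulr1 sqrtC1 !mulr1 !mul1r.
rewrite -(pair_bigA _ (fun st (e : {ffun 'I_n -> bool}) => F st.1 st.2 (e i))) /=.
rewrite -(pair_bigA _ (fun s t => \sum_(e : {ffun 'I_n -> bool}) F s t (e i))) /=.
rewrite mulr_sumr; apply: eq_bigr => s _; rewrite mulr_sumr; apply: eq_bigr => t _.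
rewrite sum_ffun_at /gain !mulr_sumr; apply: eq_bigr => b _; rewrite /F; ring.
Qed.

End Labels.

Lemma meas_ok_clickconf s l : meas_ok m (clickconf m i s l).
Proof.
apply/forallP => t; rewrite -[t]pair_ofK !clickconfE // (success_click n_gt1 succ_m).
by case: (pair_of t == _) => //; case: (l && _).
Qed.

(** The photon numbers are always those of [m]; only a psi1 photon marks its analyzer pair, [i] for
    rail 1 and [ord_pred i] for rail 0. This decides which paths interfere. *)
Lemma clickconf_eq s s' l l' :
  (clickconf m i s l == clickconf m i s' l') = (l == l') && (l ==> (s == s')).
Proof.
have at_click s1 s2 l2 : clickconf m i s2 l2
    (mode (click m (if s1 then i else ord_pred i)), true) = l2 && (s1 == s2) :> nat.
  rewrite clickconfE // anpair_click eqxx [true == _]eq_sym eqb_id.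
  by case: s1 s2 => [] []; rewrite ?eqxx //= ?(negbTE (ord_pred_neq i n_gt1)) //
    eq_sym (negbTE (ord_pred_neq i n_gt1)).
apply/eqP/andP => [E|[/eqP <- H]].
  have H1 := at_click s s l; rewrite E at_click eqxx andbT in H1.
  have H2 := at_click s' s' l'; rewrite -E at_click eqxx andbT in H2.
  by move: H1 H2; clear; case: l l' s s' => [] [] [] [].
case: l H => /= [/eqP ->|_] //; apply/ffunP => x; rewrite !ffunE.
Qed.

(** Mode 1 is rail 1 of pair 0, whose output photon is on rail [t] if [i] is 0 and on rail [s]
    otherwise. *)
Definition corr_sign (s t : bool) : algC :=
  if odd (s_odd n m) then (-1) ^+ (if i == 0 :> nat then t else s) else 1.

Lemma corr_outconf s t l : corr m (outconf i s t l) = corr_sign s t.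
Proof.
rewrite /corr /corr_sign; case: odd => //.
have n0 : (0 < n)%N by apply: ltnW.
rewrite -[1%N]/(enc (Ordinal n0, true)) !cvE !outconfE // -!val_eqE /= (eq_sym 0%N).
by case: (_ == 0%N) => /=; [case: t l => [] []|case: s].
Qed.

Section Rho.
Variables (lab : nat -> bool) (lb : bool -> bool).
Hypothesis labE : forall k b, lab (enc (k, b)) = (k == i) && lb b.
Let same := lb false == lb true.

Let coef (c : Cf n) (p : bool * bool * bool) : algC :=
  path_amp lb p.1.1 p.1.2 p.2 * corr_sign p.1.1 p.1.2 *
  (c == outconf i p.1.1 p.1.2 (lb (~~ p.2)))%:R.

Lemma corr_amp (c d : Cf n) : meas_ok m d -> dr_conf c || same ->
  corr m c * amp lab c d = gain * \sum_(p : bool * bool * bool)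
    coef c p * (d == clickconf m i p.1.1 (lb p.2))%:R.
Proof.
move=> meas_d dr; rewrite (amp_canon labE) // mulrCA; congr (_ * _).
rewrite -(pair_bigA _ (fun st b => coef c (st, b) * (d == clickconf m i st.1 (lb b))%:R)) /=.
rewrite -(pair_bigA _ (fun s t => \sum_b coef c (s, t, b) * (d == clickconf m i s (lb b))%:R)) /=.
rewrite mulr_sumr; apply: eq_bigr => s _; rewrite mulr_sumr; apply: eq_bigr => t _.
rewrite mulr_sumr; apply: eq_bigr => b _; rewrite /coef /=.
case: eqP => [->|_]; last by rewrite !(mulr0, mul0r).
by rewrite corr_outconf; ring.
Qed.

Lemma conj_coef c p : (coef c p)^* = coef c p.
Proof.
rewrite /coef /path_amp /path_sign /corr_sign -signr_odd; case: p => [[s t] b] /=.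
rewrite !rmorphM /= !conjC_nat; congr (_ * (_ * _) * _ * _).
- by rewrite rmorph_sign.
- by case: s; rewrite ?rmorph1 ?rmorph_sign.
- by case: odd; rewrite ?rmorph1 ?rmorph_sign.
Qed.

(** Tracing out the detected photons keeps a product of two paths exactly when both lead to the same
    analyzer configuration. *)
Lemma rho_pureE (c c' : Cf n) : dr_conf c && dr_conf c' || same ->
  rho_pure lab m c c' = gain * gain^* * \sum_(p : bool * bool * bool) \sum_(p' : bool * bool * bool)
    coef c p * coef c' p' * ((lb p.2 == lb p'.2) && (lb p.2 ==> (p.1.1 == p'.1.1)))%:R.
Proof.
rewrite orb_andl => /andP[dr dr']; rewrite /rho_pure.
pose D (p : bool * bool * bool) := clickconf m i p.1.1 (lb p.2).
under eq_bigr => d meas_d.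
  rewrite !corr_amp // rmorphM rmorph_sum /= mulrACA.
  rewrite [X in _ * (_ * X)](eq_bigr (fun p => coef c' p * (d == D p)%:R)); last first.
    by move=> p _; rewrite rmorphM /= conj_coef conjC_nat.
  over.
rewrite -mulr_sumr; congr (_ * _).
under eq_bigr => d _ do rewrite big_distrlr /=.
rewrite exchange_big /=; apply: eq_bigr => p _; rewrite exchange_big /=; apply: eq_bigr => p' _.
rewrite (bigD1 (D p)) ?meas_ok_clickconf //= big1 => [|d /andP[_ /negbTE neq]]; last first.
  by rewrite neq mulr0 mul0r.
by rewrite eqxx mulr1 addr0 mulrA clickconf_eq.
Qed.

End Rho.
End Amplitude.

(** * The target states *)

Section Operators.
Variable n : nat.
Implicit Types (A : Op n) (g h : Dens n) (u v : Cf n -> algC) (c : Cf n).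

Definition apply_op A v : Cf n -> algC := fun c => \sum_c0 A c c0 * v c0.

Lemma conj_op_proj A v c c' : conj_op A (proj v) c c' = proj (apply_op A v) c c'.
Proof.
rewrite /conj_op /mmul /adj /proj /apply_op rmorph_sum mulr_sumr.
apply: eq_bigr => c1 _; rewrite rmorphM /= [(A c' c1)^* * _]mulrC mulrA.
by congr (_ * _); rewrite mulr_suml; apply: eq_bigr => c0 _; rewrite mulrA.
Qed.

Lemma eq_conj_op A g h : (forall c c', g c c' = h c c') ->
  forall c c', conj_op A g c c' = conj_op A h c c'.
Proof.
move=> E c c'; apply: eq_bigr => c1 _; congr (_ * _).
by apply: eq_bigr => c0 _; rewrite E.
Qed.

Lemma conj_opD A g h c c' :
  conj_op A (dadd g h) c c' = conj_op A g c c' + conj_op A h c c'.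
Proof.
rewrite /conj_op /mmul -big_split /=; apply: eq_bigr => c1 _; rewrite -mulrDl; congr (_ * _).
by rewrite -big_split /=; apply: eq_bigr => c0 _; rewrite -mulrDr.
Qed.

Lemma conj_opZ A a g c c' : conj_op A (dscale a g) c c' = a * conj_op A g c c'.
Proof.
rewrite /conj_op /mmul mulr_sumr; apply: eq_bigr => c1 _; rewrite mulrA; congr (_ * _).
by rewrite mulr_sumr; apply: eq_bigr => c0 _; rewrite mulrCA.
Qed.

Definition superp (e : bool) (C C' : Cf n) : Cf n -> algC :=
  fun c => s2inv * ((c == C)%:R + (-1) ^+ e * (c == C')%:R).

Lemma proj_superp e C C' c c' : proj (superp e C C') c c' =
  1 / 2 * ((c == C)%:R + (-1) ^+ e * (c == C')%:R)
        * ((c' == C)%:R + (-1) ^+ e * (c' == C')%:R).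
Proof.
have half : s2inv * s2inv = 1 / 2.
  by rewrite /s2inv -invfM -expr2 sqrtCK div1r.
have conj_s2inv : s2inv^* = s2inv.
  by rewrite /s2inv fmorphV; congr (_ ^-1); apply: geC0_conj; rewrite sqrtC_ge0 ler0n.
rewrite /proj /superp rmorphM rmorphD rmorphM /= conj_s2inv rmorph_sign !conjC_nat -half.
by ring.
Qed.

Lemma eq_proj u v c c' : u =1 v -> proj u c c' = proj v c c'.
Proof. by move=> E; rewrite /proj !E. Qed.

Lemma apply_perm (f : Cf n -> Cf n) e C C' :
  apply_op (fun c c0 => (c == f c0)%:R) (superp e C C') =1 superp e (f C) (f C').
Proof.
move=> c; rewrite /apply_op /superp.
under eq_bigr => c0 _ do rewrite mulrCA mulrDr mulrCA.
rewrite -mulr_sumr big_split /= -mulr_sumr; congr (_ * (_ + _ * _)).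
  rewrite (bigD1 C) //= eqxx mulr1 big1 ?addr0 // => c0 /negbTE ->; exact: mulr0.
rewrite (bigD1 C') //= eqxx mulr1 big1 ?addr0 // => c0 /negbTE ->; exact: mulr0.
Qed.

End Operators.

(** * Target states in the basis of output configurations *)

Section Target.
Variables (n : nat) (n_gt1 : (1 < n)%N) (i : 'I_n).
Implicit Types (c : Cf n) (s t l : bool).
Local Notation O s t l := (outconf i s t l).

Let n2_gt0 : (0 < 2 * n)%N. Proof. by rewrite muln_gt0 (ltnW n_gt1). Qed.

Lemma conf_ext (c c' : Cf n) :
  (forall k r b, c (mode (k, r), b) = c' (mode (k, r), b) :> nat) -> c = c'.
Proof.
move=> E; apply/ffunP => -[x b]; apply: val_inj; rewrite -[x]pair_ofK.
by case: (pair_of x) => k r; apply: E.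
Qed.

Lemma half_enc (k : 'I_n) r : (enc (k, r))./2 = k.
Proof. by rewrite /enc /=; case: r; lia. Qed.

Lemma partner_enc (k : 'I_n) r : partner (enc (k, r)) = enc (k, ~~ r).
Proof. 
by rewrite /partner /enc /= oddD mul2n odd_double; case: r; rewrite /= ?addn0 ?addn1. Qed.

Lemma Xconf_outconf s t l : Xconf i (O s t l) = O s (~~ t) l.
Proof.
apply: conf_ext => k r b; rewrite outconfE //.
rewrite ffunE [(_, _).1]/= [(_, _).2]/= half_enc partner_enc cvE !outconfE //.
rewrite -val_eqE; case: eqP => _; rewrite nat_of_inord_bool //.
by case: r t => [] [].
Qed.

Lemma qubit_single_outconf s t l (k : 'I_n) : qubit_single k (O s t l).
Proof.
rewrite /qubit_single.
have -> : (2 * k).+1 = enc (k, true) by rewrite /enc addn1.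
have -> : (2 * k)%N = enc (k, false) by rewrite /enc addn0.
by rewrite !cvE !outconfE //; case: (if k == i then t else s); case: ((k == i) && l).
Qed.

Lemma dr_conf_outconf s t l : dr_conf (O s t l).
Proof. by apply/forallP => k; apply: qubit_single_outconf. Qed.

Lemma Dconf_outconf s t : Dconf i (O s t false) = O s t true.
Proof.
apply: conf_ext => k r b; rewrite outconfE //.
rewrite ffunE [(_, _).1]/= [(_, _).2]/= half_enc qubit_single_outconf andbT cvE !outconfE //.
rewrite -val_eqE; case: eqP => _; rewrite nat_of_inord_bool //.
by case: b.
Qed.

Lemma apply_Zop e s t l s' t' l' :
  apply_op (@Zop n i) (superp e (O s t l) (O s' t' l')) =1
  (fun c => s2inv * ((-1) ^+ t * (c == O s t l)%:R + (-1) ^+ e * ((-1) ^+ t' * (c == O s' t' l')%:R))).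
Proof.
move=> c; rewrite /apply_op /Zop (bigD1 c) //= eqxx mul1r big1 ?addr0 => [|c0]; last first.
  by rewrite eq_sym => /negbTE ->; rewrite !mul0r.
have Zsign s1 t1 l1 : (-1) ^+ (cv (O s1 t1 l1) (2 * i).+1 false + cv (O s1 t1 l1) (2 * i).+1 true)
    = (-1) ^+ t1 :> algC.
  have -> : (2 * i).+1 = enc (i, true) by rewrite /enc addn1.
  by rewrite !cvE !outconfE // eqxx; case: t1 l1 => [] [].
rewrite /superp mulrCA mulrDr; congr (_ * (_ + _)).
  by case: eqP => [->|_]; rewrite ?Zsign ?mulr0.
rewrite mulrCA; congr (_ * _).
by case: eqP => [->|_]; rewrite ?Zsign ?mulr0.
Qed.

Lemma Bplus_superp : @Bplus n =1 superp false (O false false false) (O true true false).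
Proof.
move=> c; rewrite /Bplus /superp mul1r /outconf.
by congr (_ * ((c == _)%:R + (c == _)%:R)); apply/ffunP => x; rewrite !ffunE /=;
  case: ifP; rewrite ?andbF.
Qed.

(** Averaging over [Z_i] removes the interference of the two branches, and [X_i] adds those with
    qubit [i] flipped, whence the diagonal sum; the [D_i] part stays coherent within [s = t] and
    within [s != t]. *)
Lemma target1E c c' : @target1 n i c c' = 1 / 8 *
  (\sum_s \sum_t (c == O s t false)%:R * (c' == O s t false)%:R
   + ((c == O false false true)%:R + (c == O true true true)%:R)
     * ((c' == O false false true)%:R + (c' == O true true true)%:R)
   + ((c == O false true true)%:R + (c == O true false true)%:R)
     * ((c' == O false true true)%:R + (c' == O true false true)%:R)).
Proof.
pose B l := superp false (O false false l) (O true true l).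
pose M : Dens n := dadd
  (dscale (1 / 2) (dadd (proj (B false))
     (proj (superp true (O false false false) (O true true false)))))
  (proj (B true)).
have ME c1 c2 : dadd (P_op (@Zop n i) (proj (@Bplus n)))
           (conj_op (@Dop n i) (proj (@Bplus n))) c1 c2 = M c1 c2.
  have EB d d' : proj (@Bplus n) d d' = proj (B false) d d' by apply/eq_proj/Bplus_superp.
  rewrite /dadd /P_op /dscale /dadd !(eq_conj_op _ EB) EB !conj_op_proj.
  congr (_ * (_ + _) + _); apply: eq_proj => d.
    by rewrite apply_Zop /superp; ring.
  by rewrite apply_perm !Dconf_outconf.
rewrite /target1; set M0 := dadd _ _ in ME *.
rewrite -[dscale _ _ _ _]/(1 / 2 * (1 / 2 * (M0 c c' + conj_op (@Xop n i) M0 c c'))).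
rewrite (eq_conj_op _ ME) ME.
rewrite conj_opD conj_opZ conj_opD !conj_op_proj !(eq_proj _ _ (apply_perm _ _ _ _)) !Xconf_outconf.
rewrite /M /dadd /dscale !proj_superp !big_bool.
by rewrite /= ?expr0 ?expr1; field.
Qed.

Lemma target2E c c' : @target2 n i c c' = 1 / 2 *
  ((c == O false false true)%:R * (c' == O false false true)%:R
   + (c == O true true true)%:R * (c' == O true true true)%:R).
Proof.
have ME c1 c2 : conj_op (@Dop n i) (proj (@Bplus n)) c1 c2 =
    proj (superp false (O false false true) (O true true true)) c1 c2.
  have EB d d' : proj (@Bplus n) d d' = proj (superp false (O false false false) (O true true false)) d d'.
    exact/eq_proj/Bplus_superp.
  rewrite (eq_conj_op _ EB) conj_op_proj; apply: eq_proj => d.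
  by rewrite apply_perm !Dconf_outconf.
rewrite /target2 /P_op /dscale /dadd (eq_conj_op _ ME) ME conj_op_proj.
rewrite (@eq_proj _ (apply_op (@Zop n i) _)
  (superp true (O false false true) (O true true true))); last first.
  by move=> d; rewrite apply_Zop /superp /= ?expr0 ?expr1; ring.
by rewrite !proj_superp /= ?expr0 ?expr1; field.
Qed.

Lemma outconf_inj s t l s' t' l' :
  (O s t l == O s' t' l') = [&& s == s', t == t' & l == l'].
Proof.
apply/eqP/and3P => [E|[/eqP-> /eqP-> /eqP->] //].
have p k : O s t l (mode (k, if k == i then t else s), (k == i) && l) = 1%N :> nat.
  by rewrite outconfE // !eqxx.
have := p i; rewrite E outconfE // !eqxx /= => /eqP; rewrite eqb1 => /andP[-> ->].
have := p (ord_pred i); rewrite E outconfE // (negbTE (ord_pred_neq i n_gt1)) /=.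
by case: eqP.
Qed.

Lemma sum_outconf s t l s' t' l' :
  \sum_c (c == O s t l)%:R * (c == O s' t' l')%:R =
  [&& s == s', t == t' & l == l']%:R :> algC.
Proof.
rewrite (bigD1 (O s t l)) //= eqxx mul1r big1 ?addr0 ?outconf_inj // => c /negbTE ->.
exact: mul0r.
Qed.

Lemma trace_target1 : trace (@target1 n i) = 1.
Proof.
rewrite /trace; under eq_bigr => c _ do rewrite target1E.
rewrite -mulr_sumr; under eq_bigr => c _ do rewrite !big_bool /= !mulrDl !mulrDr.
rewrite !big_split /= !sum_outconf /=.
by field.
Qed.

Lemma trace_target2 : trace (@target2 n i) = 1.
Proof.
rewrite /trace; under eq_bigr => c _ do rewrite target2E.
rewrite -mulr_sumr !big_split /= !sum_outconf /=.
by field.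
Qed.

End Target.

(** * Comparison of the heralded states with the targets *)

Lemma sum_bool3 (F : bool * bool * bool -> algC) : \sum_p F p =
  F (true, true, true) + F (true, true, false) + F (true, false, true) + F (true, false, false)
  + F (false, true, true) + F (false, true, false) + F (false, false, true) + F (false, false, false).
Proof.
transitivity (\sum_(p : bool * bool * bool) F (p.1, p.2)); first by apply: eq_bigr => -[].
rewrite -(pair_bigA _ (fun st b => F (st, b))) /=.
transitivity (\sum_(p : bool * bool) \sum_b F (p.1, p.2, b)); first by apply: eq_bigr => -[].
rewrite -(pair_bigA _ (fun s t => \sum_b F (s, t, b))) /= !big_bool /=; ring.
Qed.

Section Final.
Variables (n : nat) (n_gt1 : (1 < n)%N) (m : nat -> nat) (succ_m : success n m) (i : 'I_n).

Lemma label_secondE (k : 'I_n) b : (fun t => t == (2 * i).+1) (enc (k, b)) = (k == i) && b.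
Proof. by rewrite /enc -val_eqE /=; case: b => /=; lia. Qed.

Lemma label_firstE (k : 'I_n) b : (fun t => t == (2 * i)%N) (enc (k, b)) = (k == i) && ~~ b.
Proof. by rewrite /enc -val_eqE /=; case: b => /=; lia. Qed.

Lemma label_bothE (k : 'I_n) b : (fun t => (t == (2 * i)%N) || (t == (2 * i).+1)) (enc (k, b)) =
  (k == i) && true.
Proof. by rewrite /enc -val_eqE /=; case: b => /=; lia. Qed.

(** For each [s = t] the two choices of the detected photon of pair [i] add coherently, which gives
    4, or 8 times the prefactor of [target2E]. The detected psi1 photon reveals [s], so the branches
    do not interfere. *)
Lemma rho_both c c' : rho_pure (fun t => (t == (2 * i)%N) || (t == (2 * i).+1)) m c c' =
  8 * (gain i * (gain i)^*) * @target2 n i c c'.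
Proof.
rewrite (rho_pureE n_gt1 succ_m label_bothE) ?orbT // target2E //.
rewrite !sum_bool3 /path_amp /path_sign /corr_sign -[(-1) ^+ s_odd n m]signr_odd.
by case: (odd (s_odd n m)); case: (i == 0 :> nat); rewrite /= ?expr0 ?expr1; field.
Qed.

(** The amplitudes of the two mixture components differ by the sign [(-1) ^+ (t (+) s)], so cross
    terms between [s = t] and [s != t] cancel on average. If the detected photon of pair [i] is in
    psi1, different [s] do not interfere either and the diagonal remains; if it is in psi0, they
    stay coherent, with relative sign fixed by the correction of step (5). *)
Lemma rho_single c c' : dr_conf c -> dr_conf c' ->
  1 / 2 * rho_pure (fun t => t == (2 * i).+1) m c c' + 1 / 2 * rho_pure (fun t => t == (2 * i)%N) m c c' =
  8 * (gain i * (gain i)^*) * @target1 n i c c'.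
Proof.
move=> dr dr'.
rewrite (rho_pureE n_gt1 succ_m label_secondE) ?dr ?dr' // (rho_pureE n_gt1 succ_m label_firstE) ?dr ?dr' //.
rewrite target1E // !big_bool /= !sum_bool3 /path_amp /path_sign /corr_sign -[(-1) ^+ s_odd n m]signr_odd.
by case: (odd (s_odd n m)); case: (i == 0 :> nat); rewrite /= ?expr0 ?expr1; field.
Qed.

End Final.

Lemma normalize_scale n (rho sigma : Dens n) (a : algC) :
  (forall c c', rho c c' = a * sigma c c') -> trace sigma = 1 -> a != 0 ->
  forall c c', normalize rho c c' = sigma c c'.
Proof.
move=> E tr a0 c c'; rewrite /normalize E.
have -> : trace rho = a by rewrite /trace; under eq_bigr => d _ do rewrite E;
  rewrite -mulr_sumr -/(trace sigma) tr mulr1.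
by rewrite mulrAC divff // mul1r.
Qed.

Lemma target1_non_dr n (i : 'I_n) (c c' : Cf n) : (1 < n)%N ->
  ~~ (dr_conf c && dr_conf c') -> @target1 n i c c' = 0.
Proof.
move=> n_gt1 ndr; rewrite target1E //.
have neq d s t l : ~~ dr_conf d -> (d == outconf i s t l) = false.
  by move=> nd; apply: contraNF nd => /eqP ->; apply: dr_conf_outconf.
case/nandP: ndr => /neq nd; rewrite !big_bool !nd /=; ring.
Qed.

Theorem theorem2 (n i : nat) (m : nat -> nat) :
  (3 <= n)%N -> (i < n)%N -> @success n m ->
  (* (1) input photons in modes 2i,2i+1: the mixture
         1/2 |psi0 (2i), psi1 (2i+1)><..| + 1/2 |psi1 (2i), psi0 (2i+1)><..|,
         all other photons in psi0 *)
  (let rho1 := @rho_mix n [:: ((1 / 2)%R, fun t => t == (2 * i).+1);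
                             ((1 / 2)%R, fun t => t == (2 * i)%N)] m in
   trace rho1 != 0 ->
   forall c c' : Cf n,
     normalize (dr_proj rho1) c c' = @target1 n i c c')
  /\
  (* (2) both photons in modes 2i,2i+1 in psi1, all others in psi0;
         no dual-rail projection *)
  (let rho2 := @rho_mix n [:: (1%R, fun t => (t == (2 * i)%N) || (t == (2 * i).+1))] m in
   trace rho2 != 0 ->
   forall c c' : Cf n,
     normalize rho2 c c' = @target2 n i c c').
Proof.
move=> /ltnW n_gt1 i_lt_n succ_m; pose k : 'I_n := Ordinal i_lt_n.
have scale_neq0 : 8 * (gain k * (gain k)^*) != 0.
  by rewrite mulf_neq0 ?pnatr_eq0 // mul_conjC_eq0 gain_neq0.
split=> [rho1 _|rho2 _].
  apply: (@normalize_scale _ _ (target1 k) _ _ (trace_target1 n_gt1 k) scale_neq0) => c c'.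
  rewrite /dr_proj; case: ifP => [/andP[dr dr']|/negbT ndr]; last first.
    by rewrite target1_non_dr ?mulr0.
  by rewrite -(rho_single n_gt1 succ_m k dr dr') /rho1 /rho_mix !big_cons big_nil addr0.
apply: (@normalize_scale _ _ (target2 k) _ _ (trace_target2 n_gt1 k) scale_neq0) => c c'.
by rewrite -(rho_both n_gt1 succ_m k) /rho2 /rho_mix big_seq1 mul1r.
Qed.
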